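(* For every $K\in\mathbb{N}$ there is a constant $C_K>0$ depending only on $K$ such that for every dimension $d\in\mathbb{N}$, every $p\in[2,\infty]$ and every $f\in\ell^p(\mathbb{Z}^d)$, $$\Big\|\sup_{n_1,\dots,n_K\le\frac d{2K}}|\mathcal{D}_{n_1,\dots,n_K}f|\Big\|_{\ell^p(\mathbb{Z}^d)}\le C_K\|f\|_{\ell^p(\mathbb{Z}^d)} ,$$ where the supremum is over non-negative integers $n_1,\dots,n_K$, each at most $\frac{d}{2K}$.
   Context: $\mathbb{N}=\{1,2,\dots\}$. For $\overline n=(n_1,\dots,n_K)$ with non-negative integer entries and $n_1+\dots+n_K\le d$, let $D_{\overline n}$ be the set of $x\in\{-K,\dots,K\}^d$ such that $\#\{i\in\{1,\dots,d\}:|x_i|=j\}=n_j$ for every $j=1,\dots,K$. The averaging operator is $\mathcal{D}_{\overline n}f(x)=\frac1{|D_{\overline n}|}\sum_{y\in D_{\overline n}}f(x-y)$, $x\in\mathbb{Z}^d$. *)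

(* Defs.v *)
From HB Require Import structures.
From mathcomp Require Import all_boot all_order all_algebra finmap.
From mathcomp Require Import all_classical all_reals all_analysis.
From mathcomp.real_closed Require Import complex.

Set Implicit Arguments.
Unset Strict Implicit.
Unset Printing Implicit Defensive.

Import Order.TTheory GRing.Theory Num.Theory.

Local Open Scope classical_set_scope.
Local Open Scope ring_scope.

(* The lattice Z^d, with the discrete sigma-algebra: every function on it is
   measurable and integrals against [counting] are unordered sums. *)
Definition Zd (d : nat) : Type := 'rV[int]_d.

HB.instance Definition _ d := GRing.Zmodule.copy (Zd d) 'rV[int]_d.
HB.instance Definition _ d := isPointed.Build (Zd d) 0.
HB.instance Definition _ d :=
  @isMeasurable.Build default_measure_display (Zd d) discrete_measurable
    discrete_measurable0 discrete_measurableC discrete_measurableU.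

Definition coord d (x : Zd d) (i : 'I_d) : int := (x : 'rV[int]_d) 0 i.

Definition lp_norm (R : realType) d (p : \bar R) (g : Zd d -> \bar R) : \bar R :=
  Lnorm (@counting (Zd d) R) p g.

Definition modulus (R : realType) (z : R[i]) : R := ComplexField.Normc.normc z.

Definition in_lp (R : realType) d (p : \bar R) (f : Zd d -> R[i]) : Prop :=
  (lp_norm p (fun x => (modulus (f x))%:E) < +oo)%E.

(* The index [j : 'I_K] of the tuple [n] stands for the absolute value [j.+1]. *)
Definition Dset d K (n : 'I_K -> nat) : set (Zd d) :=
  [set x | (forall i, `|coord x i| <= K%:Z) /\
           (forall j : 'I_K, #|[set i | `|coord x i|%N == j.+1]%SET| = n j)].
Arguments Dset d {K} n.

(* Finite support is what makes [\sum_(y \in Dset d n)] an honest sum. *)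
Lemma finite_Dset d K (n : 'I_K -> nat) : finite_set (Dset d n).
Proof.
pose g (u : {ffun 'I_d -> 'I_(K + K).+1}) : Zd d :=
  \row_i ((u i)%:Z - K%:Z).
apply: (@sub_finite_set _ _ (g @` [set: {ffun 'I_d -> 'I_(K + K).+1}])).
  move=> x [xK _]; exists [ffun i => inord (absz (coord x i + K%:Z))] => //.
  apply/matrixP => a i; rewrite (ord1 a) mxE ffunE.
  have /andP[h1 h2] : - K%:Z <= coord x i <= K%:Z by rewrite -ler_norml.
  have h3 : 0 <= coord x i + K%:Z by rewrite -lerBlDr sub0r.
  rewrite inordK ?gez0_abs ?addrK// ltnS -lez_nat gez0_abs// PoszD.
  exact: lerD.
exact/finite_image/finite_finset.
Qed.

Definition Davg (R : realType) d K (n : 'I_K -> nat) (f : Zd d -> R[i])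
    (x : Zd d) : R[i] :=
  (#|` fset_set (Dset d n)|%:R)^-1 * \sum_(y \in Dset d n) f (x - y).

Definition Dmax (R : realType) d K (f : Zd d -> R[i]) (x : Zd d) : \bar R :=
  ereal_sup [set (modulus (Davg n f x))%:E |
    n in [set n : 'I_K -> nat |
           forall j, (n j)%:R <= d%:R / (2 * K%:R) :> R]].

(* Main.v *)
Require Import Defs.
From HB Require Import structures.
From mathcomp Require Import all_boot all_order all_algebra finmap.
From mathcomp Require Import perm.
From mathcomp Require Import all_classical all_reals all_analysis.
From mathcomp.real_closed Require Import complex.
From mathcomp Require Import measurable_realfun ess_sup_inf fintype finset ring lra.

(** Every average is against a probability measure, so the supremum is trivially
    bounded for p = oo, and for finite p >= 2 Jensen's inequality gives
    |D_n f|^(p/2) <= D_n (|f|^(p/2)).  Everything thus reduces to an l^2 bound for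
    nonnegative functions, in three moves.

    From K values to one.  Signed permutations of the coordinates act transitively
    on D_n, so D_n f (x) is the mean of f (x - g z) over all signed permutations g,
    for any one fixed z in D_n.  Cut the coordinates into the K residue classes
    modulo K, each of size at least d/K rounded down.  Since n_j <= d / (2K), the
    point z can carry its n_j entries of absolute value j inside the j-th class,
    using at most half of that class, and it can be averaged over all such
    positions, independently in each class.  Hence D_n f is dominated by the mean
    over g of a composition of K maximal functions, one for each class, and this
    bound does not depend on n ([shell_avg_le_majorant]).

    From Z^d to the cube.  For a fixed permutation, changing the signs and the
    positions of the entries of z moves x - g z inside an embedded copy of {0,1}^d,
    on which the operators become averages over Hamming spheres.  An l^2 bound on the
    cube, uniform in the dimension, passes to Z^d because the counting measure is
    translation invariant ([Zsum_sqr_majorant_le]).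

    Spheres in the cube ([sum_sqr_sphere_avg_le]).  Let T_n be the average over the
    Hamming sphere of radius n <= |E| / 2 in the coordinates E, and Q_n the operator
    that replaces the coordinates in a random 2n-subset of E by fair coin tosses.
    The Q_n are mixtures of reverse martingales, so Doob's inequality bounds their
    maximal function ([doob]).  Walsh characters diagonalise both families.  To
    compare eigenvalues, draw n disjoint pairs in E and obtain the sphere by flipping
    one point of each pair.  For the character of U, a pair with exactly one point in
    U contributes 0, a pair inside U contributes -1, the others 1; the eigenvalue of
    Q_n only counts draws in which no pair meets U.  The difference is therefore at
    most the probability that there is no mixed pair but some pair inside U.  Summed
    over n this is an expected waiting time, at most 3/4 as soon as U contains at most
    half of E ([sum_krawtchouk_sub_avoid_le]).  So the square function of T_n - Q_n is
    bounded on the corresponding low frequencies, and multiplication by the character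
    of E, which changes T_n only by a sign, exchanges high and low frequencies. *)

Set Implicit Arguments.
Unset Strict Implicit.
Unset Printing Implicit Defensive.

Import Order.TTheory GRing.Theory Num.Theory.

Local Open Scope ring_scope.

(** * Eigenvalues of spherical averages *)

Section Krawtchouk.
Context {R : realFieldType}.

Definition npairs (d : nat) : R := (d * d.-1)%:R.

(** The normalised Krawtchouk polynomial: the mean of (-1)^|S :&: U| over the
    n-subsets S of a set of u + v points, u of which form U, when 2n <= u + v.
    The recursion draws a random pair and puts one of its points in S; mixed pairs
    cancel, so only pairs inside U or outside U are left. *)
Fixpoint krawtchouk (n u v : nat) : R :=
  if n is n'.+1 then
    (npairs v * krawtchouk n' u v.-2 - npairs u * krawtchouk n' u.-2 v) / npairs (u + v)
  else 1.

(** The probability that n disjoint random pairs all miss the u marked points. *)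
Fixpoint avoid (n u v : nat) : R :=
  if n is n'.+1 then npairs v * avoid n' u v.-2 / npairs (u + v) else 1.

Lemma npairs_ge0 d : 0 <= npairs d. Proof. exact: ler0n. Qed.

Lemma npairsE d : npairs d = d%:R * (d%:R - 1).
Proof.
rewrite /npairs natrM; case: d => [|d]; first by rewrite !mul0r.
by rewrite -natr1 addrK natr1.
Qed.

Lemma npairs_gt0 d : (1 < d)%N -> 0 < npairs d.
Proof. by case: d => [|[|d]]// _; rewrite ltr0n. Qed.

Lemma npairs_le1 d : (d <= 1)%N -> npairs d = 0.
Proof. by case: d => [|[|]]// _; rewrite /npairs. Qed.

(** The share of a first pair drawn inside the class of a points: one step, and then
    the bound for a - 2 remaining points.  For a >= 2 the two sides agree; for a <= 1
    there is no such pair. *)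
Let npairs_wait_le (a b : nat) :
  npairs a * (1 + (b%:R / (a.-2%:R + 1) + a.-2%:R / (b%:R + 1)) / 2) <=
  npairs a + (a%:R * b%:R + npairs a * ((a%:R - 2) / (b%:R + 1))) / 2.
Proof.
have b1 : b%:R + 1 != 0 :> R by rewrite natr1 pnatr_eq0.
have [a1|] := leqP a 1.
  by rewrite npairs_le1// !mul0r add0r addr0 divr_ge0 ?mulr_ge0 ?ler0n.
case: a => [|[|a]]// _.
rewrite npairsE /= -!(@natr1 _ a.+1) -!(@natr1 _ a).
have a1 : a%:R + 1 != 0 :> R by rewrite natr1 pnatr_eq0.
by rewrite le_eqVlt; apply/orP; left; apply/eqP; field; rewrite a1 b1.
Qed.

(** [`|krawtchouk n u v|] is at most the probability that the first n pairs are
    unmixed, so the sum is bounded by the expected number of draws before a mixed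
    pair appears.  For u, v >= 2 the right-hand side solves the recursion for that
    expectation exactly, which is what makes the induction close. *)
Lemma sum_krawtchouk_le N u v :
  \sum_(n < N) `|krawtchouk n.+1 u v| <=
    (v%:R / (u%:R + 1) + u%:R / (v%:R + 1)) / 2.
Proof.
elim: N u v => [|N IH] u v.
  by rewrite big_ord0 divr_ge0 ?addr_ge0 ?divr_ge0 ?addr_ge0 ?ler0n.
have [duv|duv] := leqP (u + v) 1.
  rewrite big1 => [|n _]; last by rewrite /= (npairs_le1 duv) invr0 mulr0 normr0.
  by rewrite divr_ge0 ?addr_ge0 ?divr_ge0 ?addr_ge0 ?ler0n.
have dpos := npairs_gt0 duv.
pose W a b : R := \sum_(n < N.+1) `|krawtchouk n a b|.
have WE a b : W a b <= 1 + (b%:R / (a%:R + 1) + a%:R / (b%:R + 1)) / 2.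
  by rewrite /W big_ord_recl/= normr1 lerD2l; exact: IH.
apply: (@le_trans _ _ ((npairs v * W u v.-2 + npairs u * W u.-2 v) / npairs (u + v))).
  rewrite !mulr_sumr -big_split/= mulr_suml; apply: ler_sum => n _.
  rewrite normrM normfV (ger0_norm (npairs_ge0 _)) ler_wpM2r ?invr_ge0 ?npairs_ge0//.
  by apply: (le_trans (ler_normB _ _)); rewrite !normrM !(ger0_norm (npairs_ge0 _)).
rewrite ler_pdivrMr//.
have hu := le_trans (ler_wpM2l (npairs_ge0 u) (WE u.-2 v)) (npairs_wait_le u v).
have hv : npairs v * W u v.-2 <=
    npairs v + (v%:R * u%:R + npairs v * ((v%:R - 2) / (u%:R + 1))) / 2.
  apply: le_trans (npairs_wait_le v u); rewrite ler_wpM2l ?npairs_ge0//.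
  by rewrite [X in 1 + X / 2]addrC; exact: WE.
apply: (le_trans (lerD hv hu)); rewrite le_eqVlt; apply/orP; left; apply/eqP.
rewrite !npairsE natrD; field.
by rewrite !natr1 !pnatr_eq0.
Qed.

(** The difference only sees draws with no mixed pair and at least one pair inside the
    u points, so the sum is bounded by the expected delay between the first such pair
    and the first mixed one.  The term in u / (v + 1) absorbs the same term of
    [sum_krawtchouk_le], the constant 1 / 4 absorbs its term in v / (u + 1). *)
Lemma sum_krawtchouk_sub_avoid_le N u v :
  \sum_(n < N) `|krawtchouk n u v - avoid n u v| <= 1 / 4 + u%:R / (v%:R + 1) / 2.
Proof.
elim: N u v => [|N IH] u v.
  by rewrite big_ord0 addr_ge0 ?divr_ge0 ?addr_ge0 ?ler0n.
rewrite big_ord_recl/= subrr normr0 add0r.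
have [duv|duv] := leqP (u + v) 1.
  rewrite big1 => [|n _]; last by rewrite /= (npairs_le1 duv) invr0 !mulr0 subr0 normr0.
  by rewrite addr_ge0 ?divr_ge0 ?addr_ge0 ?ler0n.
have dpos := npairs_gt0 duv.
pose W : R := \sum_(n < N) `|krawtchouk n u.-2 v|.
pose V : R := \sum_(n < N) `|krawtchouk n u v.-2 - avoid n u v.-2|.
have WE : W <= 1 + (v%:R / (u.-2%:R + 1) + u.-2%:R / (v%:R + 1)) / 2.
  rewrite /W; case: (N) => [|N'].
    by rewrite big_ord0 addr_ge0 ?divr_ge0 ?addr_ge0 ?divr_ge0 ?addr_ge0 ?ler0n.
  by rewrite big_ord_recl/= normr1 lerD2l; exact: sum_krawtchouk_le.
have VE : V <= 1 / 4 + u%:R / (v.-2%:R + 1) / 2 by exact: IH.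
apply: (@le_trans _ _ ((npairs v * V + npairs u * W) / npairs (u + v))).
  rewrite !mulr_sumr -big_split/= mulr_suml; apply: ler_sum => n _.
  rewrite -mulrBl normrM normfV (ger0_norm (npairs_ge0 _)) ler_wpM2r ?invr_ge0 ?npairs_ge0//.
  rewrite addrAC -mulrBr; apply: (le_trans (ler_normB _ _)).
  by rewrite !normrM !(ger0_norm (npairs_ge0 _)).
rewrite ler_pdivrMr//.
have hu := le_trans (ler_wpM2l (npairs_ge0 u) WE) (npairs_wait_le u v).
have hv : npairs v * V <= npairs v / 4 + u%:R * v%:R / 2.
  apply: (le_trans (ler_wpM2l (npairs_ge0 v) VE)).
  have [v1|] := leqP v 1.
    by rewrite npairs_le1// !mul0r add0r divr_ge0 ?mulr_ge0 ?ler0n.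
  case: (v) => [|[|b]]// _.
  rewrite npairsE /= -!(@natr1 _ b.+1) -!(@natr1 _ b).
  have b1 : b%:R + 1 != 0 :> R by rewrite natr1 pnatr_eq0.
  by rewrite le_eqVlt; apply/orP; left; apply/eqP; field.
apply: (le_trans (lerD hv hu)).
rewrite -subr_ge0 [X in 0 <= X](_ : _ = npairs u / 4); first by rewrite divr_ge0 ?npairs_ge0.
by rewrite !npairsE natrD; field; rewrite !natr1 !pnatr_eq0.
Qed.

End Krawtchouk.

(** * Walsh analysis on the cube of subsets *)

Section Cube.
Context {R : realFieldType} {T : finType}.
Implicit Types (E U V x y : {set T}) (F G : {set T} -> R).

Definition symd x y : {set T} := [set i | (i \in x) (+) (i \in y)].

Lemma symdC x y : symd x y = symd y x.
Proof. by apply/setP => i; rewrite !inE addbC. Qed.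

Lemma symdA x y z : symd x (symd y z) = symd (symd x y) z.
Proof. by apply/setP => i; rewrite !inE addbA. Qed.

Lemma symdxx x : symd x x = set0.
Proof. by apply/setP => i; rewrite !inE addbb. Qed.

Lemma symd0 x : symd x set0 = x.
Proof. by apply/setP => i; rewrite !inE addbF. Qed.

Lemma symdK x y : symd (symd x y) y = x.
Proof. by rewrite -symdA symdxx symd0. Qed.

Lemma symdAC x y z : symd (symd x y) z = symd (symd x z) y.
Proof. by rewrite -!symdA (symdC y). Qed.

Lemma symd_inj y : injective (symd^~ y).
Proof. by move=> u v /(congr1 (symd^~ y)); rewrite !symdK. Qed.

Lemma sum_symd F y : \sum_x F (symd x y) = \sum_x F x.
Proof.
by rewrite [RHS](reindex_inj (@symd_inj y)).
Qed.

Definition chi U x : R := \prod_i (-1) ^+ ((i \in U) && (i \in x)).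

Lemma chiC U x : chi U x = chi x U.
Proof. by apply: eq_bigr => i _; rewrite andbC. Qed.

Lemma chi_symd U x y : chi U (symd x y) = chi U x * chi U y.
Proof.
rewrite -big_split/=; apply: eq_bigr => i _.
by rewrite inE andb_addr signr_addb.
Qed.

Lemma chi_symdl U V x : chi (symd U V) x = chi U x * chi V x.
Proof. by rewrite chiC chi_symd !(chiC x). Qed.

Lemma chi_set1 U i : chi U [set i] = (-1) ^+ (i \in U).
Proof.
rewrite /chi (bigD1 i)//= !inE eqxx andbT big1 ?mulr1// => j ji.
by rewrite inE (negbTE ji) andbF.
Qed.

Lemma chi0 U : chi U set0 = 1.
Proof. by rewrite /chi big1// => i _; rewrite inE andbF. Qed.

Lemma sum_chi U : \sum_x chi U x = (U == set0)%:R * (2 ^ #|T|)%:R.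
Proof.
have [->|/set0Pn[i iU]] := eqVneq U set0.
  rewrite (eq_bigr (fun=> 1)) => [|x _]; last by rewrite chiC chi0.
  by rewrite sumr_const mul1r -[in RHS]cardsT -card_powerset powersetT cardsT.
rewrite mul0r; suff : \sum_x chi U x = - \sum_x chi U x by lra.
rewrite -{1}(sum_symd _ [set i]) -sumrN; apply: eq_bigr => x _.
by rewrite chi_symd chi_set1 iU expr1 mulrN1.
Qed.

Lemma symd_eq0 U V : (symd U V == set0) = (U == V).
Proof.
apply/eqP/eqP => [e|->]; last exact: symdxx.
by rewrite -(symdK U V) e symdC symd0.
Qed.

Lemma chi_orthogonal U V :
  \sum_x chi U x * chi V x = (U == V)%:R * (2 ^ #|T|)%:R.
Proof.
by under eq_bigr do rewrite -chi_symdl; rewrite sum_chi symd_eq0.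
Qed.

Definition walsh (c : {set T} -> R) x := \sum_U c U * chi U x.

Lemma parseval c : \sum_x walsh c x ^+ 2 = (2 ^ #|T|)%:R * \sum_U c U ^+ 2.
Proof.
rewrite /walsh; under eq_bigr do rewrite expr2 big_distrlr/=.
rewrite exchange_big mulr_sumr; apply: eq_bigr => U _.
rewrite exchange_big (bigD1 U)//= [X in _ + X]big1 ?addr0 => [|V /negbTE VU].
  under eq_bigr do rewrite mulrACA.
  by rewrite -mulr_sumr chi_orthogonal eqxx mul1r mulrC expr2.
under eq_bigr do rewrite mulrACA.
by rewrite -mulr_sumr chi_orthogonal eq_sym VU mul0r mulr0.
Qed.

Lemma walsh_expansion F : exists c, F = walsh c.
Proof.
exists (fun U => (\sum_y F y * chi U y) / (2 ^ #|T|)%:R); apply/funext => x.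
rewrite /walsh; under eq_bigr do rewrite mulrAC mulr_suml.
rewrite -mulr_suml exchange_big/= (bigD1 x)//= [X in _ + X]big1 ?addr0.
  under eq_bigr do rewrite -mulrA chiC.
  rewrite -mulr_sumr chi_orthogonal eqxx mul1r mulfK//.
move=> y /negbTE yx; under eq_bigr do rewrite -mulrA chiC (chiC _ x).
by rewrite -mulr_sumr chi_orthogonal yx mul0r mulr0.
Qed.

(** * Averages over ordered pairs of points *)

Definition pairavg E (h : T -> T -> R) : R :=
  (\sum_(i in E) \sum_(j in E :\ i) h i j) / npairs #|E|.

Lemma eq_pairavg E (h k : T -> T -> R) :
  (forall i j, i \in E -> j \in E :\ i -> h i j = k i j) ->
  pairavg E h = pairavg E k.
Proof.
move=> hk; congr (_ / _); apply: eq_bigr => i iE; apply: eq_bigr => j jE.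
exact: hk.
Qed.

Lemma le_pairavg E (h k : T -> T -> R) :
  (forall i j, i \in E -> j \in E :\ i -> h i j <= k i j) ->
  pairavg E h <= pairavg E k.
Proof.
move=> hk; rewrite ler_wpM2r ?invr_ge0 ?npairs_ge0//.
by apply: ler_sum => i iE; apply: ler_sum => j jE; exact: hk.
Qed.

Lemma le_norm_pairavg E (h k : T -> T -> R) :
  (forall i j, i \in E -> j \in E :\ i -> `|h i j| <= k i j) ->
  `|pairavg E h| <= pairavg E k.
Proof.
move=> hk; rewrite normrM normfV (ger0_norm (npairs_ge0 _)).
rewrite ler_wpM2r ?invr_ge0 ?npairs_ge0//.
apply: (le_trans (ler_norm_sum _ _ _)); apply: ler_sum => i iE.
by apply: (le_trans (ler_norm_sum _ _ _)); apply: ler_sum => j jE; exact: hk.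
Qed.

Lemma pairavg_sum (I : Type) (r : seq I) E (h : I -> T -> T -> R) :
  pairavg E (fun i j => \sum_(k <- r) h k i j) =
  \sum_(k <- r) pairavg E (h k).
Proof.
rewrite /pairavg -mulr_suml; congr (_ / _).
by under eq_bigr do rewrite exchange_big/=; rewrite exchange_big.
Qed.

Lemma pairavgZ E c h : pairavg E (fun i j => c * h i j) = c * pairavg E h.
Proof.
rewrite /pairavg mulrA mulr_sumr; congr (_ / _).
by apply: eq_bigr => i _; rewrite mulr_sumr.
Qed.

Lemma pairavgD E h k :
  pairavg E (fun i j => h i j + k i j) = pairavg E h + pairavg E k.
Proof.
rewrite /pairavg -mulrDl -big_split/=; congr (_ / _).
by apply: eq_bigr => i _; rewrite big_split.
Qed.

Lemma sum_pairs_cst E (c : R) :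
  \sum_(i in E) \sum_(j in E :\ i) c = npairs #|E| * c.
Proof.
rewrite (eq_bigr (fun=> #|E|.-1%:R * c)) => [|i iE].
  by rewrite sumr_const -[_ *+ _]mulr_natl mulrA -natrM.
by rewrite sumr_const -[_ *+ _]mulr_natl (cardsD1 i E) iE.
Qed.

Lemma pairavg_cst E c : (1 < #|E|)%N -> pairavg E (fun _ _ => c) = c.
Proof.
by move=> E1; rewrite /pairavg sum_pairs_cst mulrC mulKf// gt_eqF// npairs_gt0.
Qed.

Lemma pairavg1_le1 E : pairavg E (fun _ _ => 1) <= 1.
Proof.
have [E1|E1] := leqP #|E| 1; last by rewrite pairavg_cst.
by rewrite /pairavg (npairs_le1 E1) invr0 mulr0.
Qed.

Lemma sqr_pairavg_le E h : pairavg E h ^+ 2 <= pairavg E (fun i j => h i j ^+ 2).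
Proof.
set m := pairavg E h.
have : 0 <= pairavg E (fun i j => (h i j - m) ^+ 2).
  rewrite divr_ge0 ?npairs_ge0// sumr_ge0// => i _; rewrite sumr_ge0// => j _.
  exact: sqr_ge0.
have -> : pairavg E (fun i j => (h i j - m) ^+ 2) =
    pairavg E (fun i j => h i j ^+ 2) - 2 * m ^+ 2 +
    m ^+ 2 * pairavg E (fun _ _ => 1).
  rewrite (eq_pairavg (k := fun i j =>
    h i j ^+ 2 + ((- 2 * m) * h i j + m ^+ 2 * 1))); last first.
    by move=> i j _ _; ring.
  by rewrite !pairavgD !pairavgZ -/m; ring.
have := pairavg1_le1 E; set u := pairavg E (fun _ _ => 1) => u1.
have := ler_wpM2l (sqr_ge0 m) u1; lra.
Qed.

(** In the eigenvalue computations the summand depends on a pair only through the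
    membership of its points in U. *)
Lemma sum_pairs E U (f : bool -> bool -> R) :
  \sum_(i in E) \sum_(j in E :\ i) f (i \in U) (j \in U) =
  npairs #|E :&: U| * f true true +
  #|E :&: U|%:R * #|E :\: U|%:R * (f true false + f false true) +
  npairs #|E :\: U| * f false false.
Proof.
have one (g : bool -> R) : \sum_(i in E) g (i \in U) =
    #|E :&: U|%:R * g true + #|E :\: U|%:R * g false.
  rewrite (big_setID U)/=; congr (_ + _).
    rewrite (eq_bigr (fun=> g true)) ?sumr_const ?mulr_natl// => i.
    by rewrite inE => /andP[_ ->].
  rewrite (eq_bigr (fun=> g false)) ?sumr_const ?mulr_natl// => i.
  by rewrite inE => /andP[/negbTE ->].
rewrite (eq_bigr (fun i => (#|E :&: U|%:R * f (i \in U) true +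
    #|E :\: U|%:R * f (i \in U) false) - f (i \in U) (i \in U))).
  by rewrite (one (fun b => _ * f b true + _ * f b false - f b b)) !npairsE; ring.
by move=> i iE; rewrite -one (big_setD1 i iE)/= addrC addrK.
Qed.

Lemma cardsI_pair E U i j : i \in E -> j \in E :\ i ->
  #|(E :\ i :\ j) :&: U| = (#|E :&: U| - (i \in U) - (j \in U))%N.
Proof.
move=> iE; rewrite 2!inE => /andP[ji jE].
have -> : (E :\ i :\ j) :&: U = (E :&: U) :\ i :\ j.
  by apply/setP => k; rewrite !inE -!andbA.
rewrite [in RHS](cardsD1 i) [in RHS](cardsD1 j) !inE ji iE jE/=.
by rewrite -subnDA addnA addKn.
Qed.

Lemma cardsD_pair E U i j : i \in E -> j \in E :\ i ->
  #|(E :\ i :\ j) :\: U| = (#|E :\: U| - (i \notin U) - (j \notin U))%N.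
Proof.
by move=> iE jE; rewrite (setDE _ U) (setDE E U) cardsI_pair// !inE.
Qed.

(** * Spherical averages and the martingale comparison *)

(** Drawing n times a random pair (i, j) in what is left of E, flipping i and
    discarding both, flips a uniformly random n-subset of E whenever 2n <= |E|
    (see [sphere_avg_eq_cst]); this form has the pair recursion for eigenvalues
    built in.  For larger n the average is 0, by division by 0. *)
Fixpoint sphere_avg n E F x : R :=
  if n is n'.+1 then
    pairavg E (fun i j => sphere_avg n' (E :\ i :\ j) F (symd x [set i]))
  else F x.

(** The conditional expectation that forgets the coordinate i. *)
Definition flipavg i F x : R := (F x + F (symd x [set i])) / 2.

Fixpoint resample_avg n E F x : R :=
  if n is n'.+1 then
    pairavg E (fun i j => resample_avg n' (E :\ i :\ j) (flipavg i (flipavg j F)) x)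
  else F x.

(** The reverse martingale runs along a random sequence of pairs.  Taking the maximum
    inside the average over the next pair, rather than after averaging, keeps Doob's
    argument available and still dominates every [resample_avg]. *)
Fixpoint resample_max n E F x : R :=
  if n is n'.+1 then
    Num.max (F x) (pairavg E (fun i j =>
      resample_max n' (E :\ i :\ j) (flipavg i (flipavg j F)) x))
  else F x.

Lemma sphere_avg_chi n E U x :
  sphere_avg n E (chi U) x = krawtchouk n #|E :&: U| #|E :\: U| * chi U x.
Proof.
elim: n E x => [|n IH] E x; first by rewrite mul1r.
rewrite /= (eq_pairavg (k := fun i j => chi U x * ((-1) ^+ (i \in U) *
   krawtchouk n (#|E :&: U| - (i \in U) - (j \in U))
     (#|E :\: U| - (i \notin U) - (j \notin U))))); last first.
  move=> i j iE jE; rewrite IH cardsI_pair// cardsD_pair// chi_symd chi_set1.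
  by ring.
rewrite pairavgZ /pairavg (sum_pairs _ _ (fun a b => (-1) ^+ a *
   krawtchouk n (#|E :&: U| - a - b) (#|E :\: U| - ~~ a - ~~ b))) /=.
by rewrite -(cardsID U E) !subn0 !subn1 expr0 expr1; ring.
Qed.

Lemma flipavg_chi i U : flipavg i (chi U) = fun x => (i \notin U)%:R * chi U x.
Proof.
apply/funext => x; rewrite /flipavg chi_symd chi_set1.
by case: (i \in U); rewrite /= ?expr0 ?expr1; field.
Qed.

Lemma flipavg_sum (I : Type) (r : seq I) i (c : I -> R) (F : I -> {set T} -> R) :
  flipavg i (fun x => \sum_(k <- r) c k * F k x) =
  fun x => \sum_(k <- r) c k * flipavg i (F k) x.
Proof.
apply/funext => x; rewrite /flipavg -big_split mulr_suml/=.
by apply: eq_bigr => k _; rewrite -mulrDr mulrA.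
Qed.

Lemma sphere_avg_sum (I : Type) (r : seq I) (c : I -> R) (F : I -> {set T} -> R) n E x :
  sphere_avg n E (fun x => \sum_(k <- r) c k * F k x) x =
  \sum_(k <- r) c k * sphere_avg n E (F k) x.
Proof.
elim: n E x => [//|n IH] E x /=.
under eq_pairavg do rewrite IH.
by rewrite pairavg_sum; apply: eq_bigr => k _; exact: pairavgZ.
Qed.

Lemma resample_avg_sum (I : Type) (r : seq I) (c : I -> R) (F : I -> {set T} -> R) n E x :
  resample_avg n E (fun x => \sum_(k <- r) c k * F k x) x =
  \sum_(k <- r) c k * resample_avg n E (F k) x.
Proof.
elim: n E F => [//|n IH] E F /=.
under eq_pairavg do rewrite !flipavg_sum IH.
by rewrite pairavg_sum; apply: eq_bigr => k _; exact: pairavgZ.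
Qed.

Lemma resample_avgZ n E c F x :
  resample_avg n E (fun x => c * F x) x = c * resample_avg n E F x.
Proof.
have := resample_avg_sum [:: tt] (fun=> c) (fun=> F) n E x; rewrite big_seq1 => <-.
by congr resample_avg; apply/funext => y; rewrite big_seq1.
Qed.

Lemma resample_avg_chi n E U x :
  resample_avg n E (chi U) x = avoid n #|E :&: U| #|E :\: U| * chi U x.
Proof.
elim: n E => [|n IH] E; first by rewrite mul1r.
rewrite /= (eq_pairavg (k := fun i j => chi U x *
   ((i \notin U)%:R * (j \notin U)%:R *
   avoid n (#|E :&: U| - (i \in U) - (j \in U))
     (#|E :\: U| - (i \notin U) - (j \notin U))))); last first.
  move=> i j iE jE; rewrite flipavg_chi.
  have -> : flipavg i (fun y => (j \notin U)%:R * chi U y) =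
      fun y => ((i \notin U)%:R * (j \notin U)%:R) * chi U y.
    apply/funext => y; rewrite -[RHS]mulrA mulrCA.
    by rewrite -(congr1 (@^~ y) (flipavg_chi i U)) /flipavg; ring.
  by rewrite resample_avgZ IH cardsI_pair// cardsD_pair//; ring.
rewrite pairavgZ /pairavg (sum_pairs _ _ (fun a b => (~~ a)%:R * (~~ b)%:R *
   avoid n (#|E :&: U| - a - b) (#|E :\: U| - ~~ a - ~~ b))) /=.
by rewrite -(cardsID U E) !subn0 !subn1; ring.
Qed.

Lemma resample_avg_le_max n N E F x : (n <= N)%N ->
  resample_avg n E F x <= resample_max N E F x.
Proof.
elim: N n E F => [|N IH] [|n] E F //=; first by rewrite le_max lexx.
rewrite ltnS => nN; rewrite le_max; apply/orP; right.
by apply: le_pairavg => i j _ _; exact: IH.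
Qed.

Lemma norm_resample_avg_le n E F G x : (forall y, `|F y| <= G y) ->
  `|resample_avg n E F x| <= resample_avg n E G x.
Proof.
elim: n E F G => [//|n IH] E F G FG /=.
apply: le_norm_pairavg => i j _ _; apply: IH => y.
have flip k (F' G' : {set T} -> R) : (forall y, `|F' y| <= G' y) ->
    forall y, `|flipavg k F' y| <= flipavg k G' y.
  move=> FG' z; rewrite /flipavg normrM (@ger0_norm _ 2^-1) ?invr_ge0//.
  by rewrite ler_pM2r ?invr_gt0// (le_trans (ler_normD _ _))// lerD.
by move: y; apply/flip/flip.
Qed.

Lemma norm_sphere_avg_le n E F G x : (forall y, `|F y| <= G y) ->
  `|sphere_avg n E F x| <= sphere_avg n E G x.
Proof.
by elim: n E x => [//|n IH] E x FG /=; apply: le_norm_pairavg => i j _ _; exact: IH.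
Qed.

Definition flip_invariant k F := forall x, F (symd x [set k]) = F x.

Lemma flipavg_invariant k F : flip_invariant k (flipavg k F).
Proof. by move=> x; rewrite /flipavg symdK addrC. Qed.

Lemma flipavg_invariantW i k F : flip_invariant k F -> flip_invariant k (flipavg i F).
Proof. by move=> Fk x; rewrite /flipavg symdAC !Fk. Qed.

Lemma resample_max_invariant k n E F : flip_invariant k F ->
  flip_invariant k (resample_max n E F).
Proof.
elim: n E F => [//|n IH] E F Fk x /=; rewrite Fk; congr Num.max.
by apply: eq_pairavg => i j _ _; rewrite IH//; exact/flipavg_invariantW/flipavg_invariantW.
Qed.

(** A conditional expectation is self-adjoint and fixes invariant functions. *)
Lemma sum_flipavg_invariant k F G : flip_invariant k G ->
  \sum_x flipavg k F x * G x = \sum_x F x * G x.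
Proof.
move=> Gk; rewrite /flipavg.
under eq_bigr do rewrite mulrDl mulrDl.
rewrite big_split/=.
rewrite [X in _ + X](_ : _ = \sum_x F x / 2 * G x).
  by rewrite -big_split/=; apply: eq_bigr => x _; field.
rewrite -[RHS](sum_symd _ [set k]).
by apply: eq_bigr => x _; rewrite Gk.
Qed.

(** Doob's argument, one step at a time.  With N the maximum over the later steps,
    max(F, N)^2 - N^2 <= 2 F (max(F, N) - N) pointwise; and since the later maxima are
    invariant under the flips already averaged out, the induction hypothesis for
    the averaged F pairs them equally well with F itself. *)
Lemma doob_bilinear n E F :
  \sum_x resample_max n E F x ^+ 2 <= 2 * \sum_x F x * resample_max n E F x.
Proof.
elim: n E F => [|n IH] E F /=.
  rewrite mulr_sumr; apply: ler_sum => x _; rewrite -expr2.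
  by rewrite ler_peMl ?sqr_ge0// ler1n.
pose N x := pairavg E (fun i j =>
  resample_max n (E :\ i :\ j) (flipavg i (flipavg j F)) x).
have HN : \sum_x N x ^+ 2 <= 2 * \sum_x F x * N x.
  apply: (@le_trans _ _ (pairavg E (fun i j => \sum_x
    resample_max n (E :\ i :\ j) (flipavg i (flipavg j F)) x ^+ 2))).
    by rewrite pairavg_sum; apply: ler_sum => x _; exact: sqr_pairavg_le.
  under [in leRHS]eq_bigr do rewrite /N -pairavgZ.
  rewrite -pairavg_sum -pairavgZ; apply: le_pairavg => i j iE jE.
  apply: (le_trans (IH _ _)); rewrite sum_flipavg_invariant.
    rewrite sum_flipavg_invariant//.
    apply/resample_max_invariant/flipavg_invariantW/flipavg_invariant.
  exact/resample_max_invariant/flipavg_invariant.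
rewrite -subr_ge0 in HN; rewrite -subr_ge0.
apply: (le_trans HN); rewrite !mulr_sumr -!sumrB; apply: ler_sum => x _.
rewrite -/(N x) maxEle; case: ifP => // /negbT; rewrite -ltNge => /ltW NF.
have := sqr_ge0 (F x - N x); nra.
Qed.

Lemma doob n E F :
  \sum_x resample_max n E F x ^+ 2 <= 4 * \sum_x F x ^+ 2.
Proof.
have := doob_bilinear n E F.
suff : 2 * \sum_x F x * resample_max n E F x <=
  2 * \sum_x F x ^+ 2 + 2^-1 * \sum_x resample_max n E F x ^+ 2 by lra.
rewrite !mulr_sumr -big_split/=; apply: ler_sum => x _.
have := sqr_ge0 (2 * F x - resample_max n E F x); nra.
Qed.

(** * The maximal inequality for spheres in the cube *)

Definition low_freq E U := (#|E :&: U| <= #|E :\: U|)%N.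

Lemma sum_sqr_krawtchouk_sub_avoid_le N u v : (u <= v)%N ->
  \sum_(n < N) (krawtchouk n u v - avoid n u v : R) ^+ 2 <= 1.
Proof.
move=> uv; have H M : \sum_(n < M) `|krawtchouk n u v - avoid n u v : R| <= 3 / 4.
  apply: (le_trans (sum_krawtchouk_sub_avoid_le _ _ _)).
  have : u%:R / (v%:R + 1) <= 1 :> R.
    by rewrite natr1 ler_pdivrMr ?ltr0n// mul1r ler_nat ltnW.
  lra.
apply: (@le_trans _ _ (\sum_(n < N) `|krawtchouk n u v - avoid n u v : R|)).
  apply: ler_sum => n _; rewrite -(real_normK (num_real _)) expr2 ler_piMl//.
  have := H n.+1; rewrite big_ord_recr/=.
  have : 0 <= \sum_(i < n) `|krawtchouk i u v - avoid i u v : R|.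
    by rewrite sumr_ge0.
  lra.
apply: (le_trans (H N)); lra.
Qed.

(** The radius is allowed to depend on the point, which linearises the supremum:
    T_n F is at most the maximal function of the Q_n plus the full square function of
    T_n - Q_n, and the latter is computed on the Walsh side. *)
Lemma sum_sphere_avg_low (nu : {set T} -> nat) N E c :
  (forall x, (nu x < N)%N) -> (forall U, ~~ low_freq E U -> c U = 0) ->
  \sum_x sphere_avg (nu x) E (walsh c) x ^+ 2 <= 10 * \sum_x walsh c x ^+ 2.
Proof.
move=> nuN clow.
pose del n U : R := krawtchouk n #|E :&: U| #|E :\: U| - avoid n #|E :&: U| #|E :\: U|.
have delE n x : sphere_avg n E (walsh c) x - resample_avg n E (walsh c) x =
    walsh (fun U => c U * del n U) x.
  rewrite sphere_avg_sum resample_avg_sum -sumrB; apply: eq_bigr => U _.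
  by rewrite sphere_avg_chi resample_avg_chi /del; ring.
pose A x := `|walsh c x|.
have pt x : sphere_avg (nu x) E (walsh c) x ^+ 2 <= 2 * resample_max N E A x ^+ 2 +
    2 * \sum_(n < N) walsh (fun U => c U * del n U) x ^+ 2.
  apply: (@le_trans _ _ (2 * resample_max N E A x ^+ 2 +
      2 * walsh (fun U => c U * del (nu x) U) x ^+ 2)); last first.
    rewrite lerD2l ler_pM2l// (bigD1 (Ordinal (nuN x)))//= lerDl sumr_ge0//.
    by move=> n _; exact: sqr_ge0.
  rewrite -delE; set s := sphere_avg _ _ _ _; set r := resample_avg _ _ _ _.
  have rM : `|r| <= resample_max N E A x.
    apply: (le_trans (norm_resample_avg_le _ _ (G := A) _ _)) => //.
    exact/resample_avg_le_max/ltnW.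
  have : r ^+ 2 <= resample_max N E A x ^+ 2.
    by rewrite -(real_normK (num_real r)) lerXn2r ?nnegrE// (le_trans _ rM).
  have := sqr_ge0 (2 * r - s); nra.
apply: (le_trans (ler_sum _ (fun x _ => pt x))).
rewrite big_split/= -!mulr_sumr.
have h1 : \sum_x resample_max N E A x ^+ 2 <= 4 * \sum_x walsh c x ^+ 2.
  apply: (le_trans (doob _ _ _)); rewrite ler_pM2l//; apply: ler_sum => x _.
  by rewrite /A real_normK ?num_real.
have h2 : \sum_x \sum_(n < N) walsh (fun U => c U * del n U) x ^+ 2 <=
    \sum_x walsh c x ^+ 2.
  rewrite exchange_big/= parseval; under eq_bigr do rewrite parseval.
  rewrite -mulr_sumr ler_wpM2l ?ler0n// exchange_big/=; apply: ler_sum => U _.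
  have [Ul|/clow ->] := boolP (low_freq E U); last first.
    by rewrite expr0n/= big1// => n _; rewrite mul0r expr0n.
  under eq_bigr do rewrite exprMn.
  by rewrite -mulr_sumr ler_piMr ?sqr_ge0// sum_sqr_krawtchouk_sub_avoid_le.
lra.
Qed.

(** All n flips happen inside W, and each of them changes the sign of [chi W]. *)
Lemma sphere_avg_parity n E (W : {set T}) F x : E \subset W ->
  sphere_avg n E (fun y => chi W y * F y) x = (-1) ^+ n * chi W x * sphere_avg n E F x.
Proof.
elim: n E x => [|n IH] E x EW; first by rewrite mul1r.
rewrite /= -pairavgZ; apply: eq_pairavg => i j iE jE.
rewrite IH; last by rewrite !(subset_trans (subsetDl _ _)).
by rewrite chi_symd chi_set1 (subsetP EW)// expr1 exprS; ring.
Qed.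

Lemma low_freq_symd E U : ~~ low_freq E (symd E U) -> low_freq E U.
Proof.
rewrite /low_freq -ltnNge => /ltnW.
have -> : E :&: symd E U = E :\: U.
  by apply/setP => i; rewrite !inE; case: (i \in E); case: (i \in U).
have -> : E :\: symd E U = E :&: U => //.
by apply/setP => i; rewrite !inE; case: (i \in E); case: (i \in U).
Qed.

Lemma chi_walsh E c x : chi E x * walsh c x = walsh (fun U => c (symd E U)) x.
Proof.
rewrite /walsh mulr_sumr [RHS](reindex_inj (@symd_inj E)).
apply: eq_bigr => U _; rewrite (symdC U) symdA symdxx (symdC set0) symd0.
by rewrite chi_symdl; ring.
Qed.

(** On frequencies U with more than half of E, multiplication by [chi E] replaces U by
    [symd E U], which is low, and leaves [sphere_avg] unchanged up to sign. *)
Theorem sum_sqr_sphere_avg_le (nu : {set T} -> nat) N E F :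
  (forall x, (nu x < N)%N) ->
  \sum_x sphere_avg (nu x) E F x ^+ 2 <= 20 * \sum_x F x ^+ 2.
Proof.
move=> nuN; have [c ->] := walsh_expansion F.
pose cl U := if low_freq E U then c U else 0.
pose ch U := if low_freq E U then 0 else c U.
have cE : walsh c = fun x => \sum_(k <- [:: cl; ch]) 1 * walsh k x.
  apply/funext => x; rewrite big_cons big_seq1 !mul1r -big_split/=.
  by apply: eq_bigr => U _; rewrite -mulrDl /cl /ch; case: ifP; rewrite ?addr0 ?add0r.
have Hl : \sum_x sphere_avg (nu x) E (walsh cl) x ^+ 2 <= 10 * \sum_x walsh cl x ^+ 2.
  by apply: (sum_sphere_avg_low nuN) => U /negbTE Ul; rewrite /cl Ul.
have Hh : \sum_x sphere_avg (nu x) E (walsh ch) x ^+ 2 <= 10 * \sum_x walsh ch x ^+ 2.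
  have chi2 x : chi E x ^+ 2 = 1 by rewrite expr2 -chi_symdl symdxx chiC chi0.
  have e x n : sphere_avg n E (walsh ch) x ^+ 2 =
      sphere_avg n E (walsh (fun U => ch (symd E U))) x ^+ 2.
    rewrite -(funext (chi_walsh E ch)) sphere_avg_parity//.
    by rewrite !exprMn chi2 sqrr_sign !mul1r.
  under eq_bigr do rewrite e.
  apply: (@le_trans _ _ (10 * \sum_x walsh (fun U => ch (symd E U)) x ^+ 2)).
    apply: (sum_sphere_avg_low nuN) => U Uh; rewrite /ch ifT//; apply: low_freq_symd.
    by rewrite symdA symdxx symdC symd0.
  rewrite ler_pM2l//; apply: ler_sum => x _.
  by rewrite -chi_walsh exprMn chi2 mul1r.
have sE x : sphere_avg (nu x) E (walsh c) x ^+ 2 <=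
    2 * sphere_avg (nu x) E (walsh cl) x ^+ 2 + 2 * sphere_avg (nu x) E (walsh ch) x ^+ 2.
  rewrite cE sphere_avg_sum big_cons big_seq1 !mul1r.
  have := sqr_ge0 (sphere_avg (nu x) E (walsh cl) x - sphere_avg (nu x) E (walsh ch) x); nra.
apply: (le_trans (ler_sum _ (fun x _ => sE x))).
rewrite big_split/= -!mulr_sumr.
have -> : \sum_x walsh c x ^+ 2 = \sum_x walsh cl x ^+ 2 + \sum_x walsh ch x ^+ 2.
  rewrite !parseval -mulrDr -big_split/=; congr (_ * _); apply: eq_bigr => U _.
  by rewrite /cl /ch; case: ifP; rewrite expr0n/= ?addr0 ?add0r.
lra.
Qed.

Definition sphere_max N E F x := \big[Num.max/0]_(n < N) sphere_avg n E F x.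

Lemma sphere_max_ge n N E F x : (n < N)%N ->
  sphere_avg n E F x <= sphere_max N E F x.
Proof.
move=> nN.
exact: (le_bigmax _ (fun n : 'I_N => sphere_avg n E F x) (Ordinal nN)).
Qed.

Lemma sum_sqr_sphere_max_le N E F :
  \sum_x sphere_max N E F x ^+ 2 <= 20 * \sum_x F x ^+ 2.
Proof.
(* Radius 0 serves when the maximum is 0, even over an empty range of radii. *)
have pick x : exists n,
    (n < N.+1)%N && (sphere_max N E F x ^+ 2 <= sphere_avg n E F x ^+ 2).
  apply: (big_ind (fun m => exists n,
    (n < N.+1)%N && (m ^+ 2 <= sphere_avg n E F x ^+ 2))) => [|a b aP bP|i _].
  - by exists 0%N; rewrite expr0n sqr_ge0.
  - by rewrite maxEle; case: ifP.
  - by exists i; rewrite lexx andbT ltnS ltnW.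
pose nu x := xchoose (pick x).
have nuP x := andP (xchooseP (pick x)).
apply: (@le_trans _ _ (\sum_x sphere_avg (nu x) E F x ^+ 2)).
  by apply: ler_sum => x _; case: (nuP x).
by apply: (@sum_sqr_sphere_avg_le nu N.+1) => x; case: (nuP x).
Qed.

(** * Compositions over disjoint blocks *)

Section Blocks.
Context {I : eqType} (E : I -> {set T}) (n : I -> nat).

Fixpoint block_avg r F : {set T} -> R :=
  if r is j :: r' then sphere_avg (n j) (E j) (block_avg r' F) else F.

Fixpoint block_max N r F : {set T} -> R :=
  if r is j :: r' then sphere_max N (E j) (block_max N r' F) else F.

Lemma sum_sqr_block_max_le N r F :
  \sum_x block_max N r F x ^+ 2 <= 20 ^+ size r * \sum_x F x ^+ 2.
Proof.
elim: r => [|j r IH] /=; first by rewrite mul1r.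
apply: (le_trans (sum_sqr_sphere_max_le _ _ _)).
by rewrite exprS -mulrA ler_pM2l.
Qed.

Lemma norm_block_avg_le N r F x : (forall j, n j < N)%N ->
  (forall y, 0 <= F y) -> `|block_avg r F x| <= block_max N r F x.
Proof.
move=> nN F0; elim: r x => [|j r IH] x /=; first by rewrite ger0_norm.
exact: le_trans (norm_sphere_avg_le _ _ _ IH) (sphere_max_ge _ _ _ (nN j)).
Qed.

Lemma sphere_avg_symd m (D : {set T}) F x y :
  sphere_avg m D F (symd x y) = sphere_avg m D (fun z => F (symd z y)) x.
Proof.
elim: m D x => [//|m IH] D x /=.
by apply: eq_pairavg => i j _ _; rewrite symdAC IH.
Qed.

Lemma block_avg_symd r F x y :
  block_avg r F (symd x y) = block_avg r (fun z => F (symd z y)) x.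
Proof.
elim: r x => [//|j r IH] x /=.
by rewrite sphere_avg_symd; congr (sphere_avg _ _ _ _); apply/funext => z; exact: IH.
Qed.

Lemma block_avg_sum (J : Type) (s : seq J) (F : J -> {set T} -> R) r x :
  block_avg r (fun y => \sum_(k <- s) F k y) x =
  \sum_(k <- s) block_avg r (F k) x.
Proof.
elim: r x => [//|j r IH] x /=.
rewrite [X in sphere_avg _ _ X](_ : _ = fun y => \sum_(k <- s) 1 * block_avg r (F k) y).
  by rewrite sphere_avg_sum; apply: eq_bigr => k _; rewrite mul1r.
by apply/funext => y; rewrite IH; apply: eq_bigr => k _; rewrite mul1r.
Qed.

(** [sphere_avg m D] is carried by the m-subsets of D, with total mass 1.  Stated through
    functions constant on the sphere: only such functions are averaged in the end,
    so the weights themselves are never computed. *)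
Lemma sphere_avg_eq_cst m (D : {set T}) F x c : (m.*2 <= #|D|)%N ->
  (forall S : {set T}, S \subset D -> #|S| = m -> F (symd x S) = c) ->
  sphere_avg m D F x = c.
Proof.
elim: m D x => [|m IH] D x /= mD Fc.
  by rewrite -(Fc set0) ?symd0 ?sub0set ?cards0.
rewrite -[RHS](pairavg_cst (E := D)) ?(leq_trans _ mD)//.
apply: eq_pairavg => i j iD jD; apply: IH => [|S SD Sm].
  move: mD; rewrite (cardsD1 i D) iD (cardsD1 j (D :\ i)) jD/= doubleS.
  by rewrite !add1n !ltnS.
have iS : i \notin S by apply/negP => /(subsetP SD); rewrite !inE eqxx andbF.
rewrite -symdA; apply: Fc.
  apply/subsetP => k; rewrite !inE; case: eqVneq => [->//|_].
  by move=> /(subsetP SD); rewrite !inE => /and3P[].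
rewrite -Sm (cardsD1 i (symd _ _)) !inE eqxx (negbTE iS)/= add1n; congr _.+1.
apply: eq_card => k; rewrite !inE; case: eqVneq => [->|_]//.
by rewrite (negbTE iS).
Qed.

Lemma block_avg_eq_cst r F x c :
  uniq r -> (forall j, j \in r -> (n j).*2 <= #|E j|)%N ->
  {in r &, forall j k, j != k -> [disjoint E j & E k]} ->
  (forall S : {set T}, {in r, forall j, #|S :&: E j| = n j} ->
    {in S, forall i, has (fun j => i \in E j) r} -> F (symd x S) = c) ->
  block_avg r F x = c.
Proof.
elim: r x => [|j r IH] x /=.
  by move=> _ _ _ /(_ set0); rewrite symd0; apply => // i; rewrite inE.
move=> /andP[jr ur] nE dE Fc.
apply: sphere_avg_eq_cst => [|S SE Sn]; first by rewrite nE ?mem_head.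
have disj k i : k \in r -> i \in E j -> i \in E k -> false.
  move=> kr ij ik; have kj : j != k by apply: contraNneq jr => ->.
  have := dE j k (mem_head _ _) _ kj; rewrite inE kr orbT => /(_ isT).
  by move=> /pred0P/(_ i)/=; rewrite ij ik.
apply: IH => // [k kr|k l kr lr|S' S'n S'r].
- by rewrite nE// inE kr orbT.
- by apply: dE; rewrite inE ?kr ?lr orbT.
rewrite -symdA; apply: Fc => [k|i].
  rewrite inE => /predU1P[->|kr].
    rewrite -Sn; apply: eq_card => i; rewrite !inE.
    case: (boolP (i \in E j)) => [ij|]; rewrite ?andbF ?andbT.
      case: (boolP (i \in S')) => [/S'r/hasP[l lr il]|_]; last by rewrite addbF.
      by have := disj l i lr ij il.
    by move=> iE; apply/esym/negbTE; apply: contra iE => /(subsetP SE).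
  rewrite -(S'n k kr); apply: eq_card => i; rewrite !inE.
  case: (boolP (i \in E k)) => [ik|]; rewrite ?andbF ?andbT//.
  case: (boolP (i \in S)) => [/(subsetP SE) ij|_]; last by rewrite addFb.
  by have := disj k i kr ij ik.
rewrite !inE; case: (boolP (i \in S)) => [/(subsetP SE) ->//|_] /= /S'r ->.
by rewrite orbT.
Qed.

End Blocks.
End Cube.

(** * Signed permutations and the shells in Z^d *)

Section Lattice.
Local Notation coord := Defs.coord.
Context {d K : nat}.
Hypothesis K0 : (0 < K)%N.
Implicit Types (z : Zd d) (S : {set 'I_d}) (g : 'S_d * {set 'I_d}).

Definition residue_block (j : 'I_K) : {set 'I_d} := [set i : 'I_d | (i %% K)%N == j]%SET.

(** For p = 1, the corner S of the cube goes to the point whose coordinate i in S is the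
    absolute value attached to the residue class of i.  The permutation p relabels
    the coordinates. *)
Definition embed (p : 'S_d) S : Zd d :=
  \row_i (if p i \in S then (p i %% K).+1%N%:Z else 0).

Definition signed_perm g z : Zd d :=
  \row_i ((-1) ^+ (g.1 i \in g.2) * coord z (g.1 i)).

Lemma coord_embed p S i :
  coord (embed p S) i = if p i \in S then (p i %% K).+1%N%:Z else 0.
Proof. by rewrite /coord mxE. Qed.

Lemma coord_signed_perm g z i :
  coord (signed_perm g z) i = (-1) ^+ (g.1 i \in g.2) * coord z (g.1 i).
Proof. by rewrite /coord mxE. Qed.

Lemma coord_inj z z' : (forall i, coord z i = coord z' i) -> z = z'.
Proof. by move=> e; apply/rowP => i; exact: e. Qed.

(** Flipping S from the corner w moves the embedded point by an element of the signed
    permutation orbit of [embed 1 S]; the corner w provides the signs. *)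
Lemma embed_symd p (w S : {set 'I_d}) :
  embed p w - embed p (symd w S) = - signed_perm (p, w) (embed 1 S).
Proof.
apply/rowP => i; rewrite !mxE/= coord_embed perm1 inE.
by case: (p i \in w); case: (p i \in S) => /=; ring.
Qed.

Lemma abs_signed_perm g z i :
  `|coord (signed_perm g z) i|%N = `|coord z (g.1 i)|%N.
Proof. by rewrite coord_signed_perm abszM; case: (_ \in _); rewrite ?mul1n. Qed.

Lemma Dset_abs (n : 'I_K -> nat) z z' (p : 'S_d) :
  (forall i, `|coord z' i|%N = `|coord z (p i)|%N) -> Dset d n z -> Dset d n z'.
Proof.
move=> zz' [zK zn]; split=> [i|j].
  by rewrite -abszE zz' abszE.
rewrite -zn -[RHS](card_preimset _ (@perm_inj _ p)).
by apply: eq_card => i; rewrite !inE zz'.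
Qed.

Lemma signed_perm_Dset (n : 'I_K -> nat) g z :
  Dset d n z -> Dset d n (signed_perm g z).
Proof. exact: Dset_abs (abs_signed_perm g z). Qed.

Lemma embed_Dset (n : 'I_K -> nat) S :
  (forall j, #|S :&: residue_block j| = n j) -> Dset d n (embed 1 S).
Proof.
move=> Sn; split=> [i|j].
  rewrite coord_embed; case: ifP => _; rewrite ?normr0//.
  by rewrite perm1 ger0_norm// lez_nat ltn_mod.
rewrite -Sn; apply: eq_card => i; rewrite !inE coord_embed perm1.
by case: (i \in S).
Qed.

Lemma signed_perm_inj g : injective (signed_perm g).
Proof.
move=> z z' e; apply: coord_inj => i.
have := congr1 (fun y : Zd d => coord y ((g.1)^-1 i)%g) e.
rewrite !coord_signed_perm permKV.
by move=> /(congr1 ( *%R ((-1) ^+ (i \in g.2)))); rewrite !signrMK.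
Qed.

Definition signed_perm_mul g' g : 'S_d * {set 'I_d} :=
  ((g.1 * g'.1)%g, symd [set k | (g'.1)^-1 k \in g.2]%SET g'.2)%g.

Lemma signed_perm_mulP g g' z :
  signed_perm g (signed_perm g' z) = signed_perm (signed_perm_mul g' g) z.
Proof.
apply: coord_inj => i; rewrite !coord_signed_perm/= !inE permM permK.
by rewrite signr_addb mulrA.
Qed.

Lemma signed_perm_mul_inj g' : injective (signed_perm_mul g').
Proof.
move=> [p w] [q v] [/(@mulIg _ _) pq]; rewrite {}pq => /symd_inj wv.
congr (_, _); apply/setP => k.
by have := congr1 (fun A : {set 'I_d} => g'.1 k \in A) wv; rewrite !inE permK.
Qed.

Lemma card_cond_enum (P : pred 'I_d) : #|[set i | P i]%SET| = count P (enum 'I_d).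
Proof. by rewrite cardsE cardE -size_filter enumT /enum_mem. Qed.

(** Membership in the shell prescribes the number of zero coordinates as well, so that
    two points of the shell have the same multiset of absolute values. *)
Lemma Dset_card0 (n : 'I_K -> nat) z : Dset d n z ->
  (#|[set i | `|coord z i|%N == 0]%SET| + \sum_j n j = d)%N.
Proof.
move=> [zK zn]; rewrite -[RHS]card_ord -[RHS]sum1_card.
rewrite [RHS](partition_big (fun i => inord `|coord z i|%N : 'I_K.+1) predT)//=.
have zi i : (`|coord z i| < K.+1)%N by rewrite ltnS -lez_nat abszE.
rewrite [RHS]big_ord_recl; congr (_ + _)%N.
  rewrite sum1_card; apply: eq_card => i; rewrite !inE /= unfold_in /=.
  by rewrite inordK.
apply: eq_bigr => j _; rewrite -zn sum1_card; apply: eq_card => i.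
by rewrite !inE [RHS]unfold_in/= inordK.
Qed.

Lemma Dset_transitive (n : 'I_K -> nat) z z' : Dset d n z -> Dset d n z' ->
  exists g, z' = signed_perm g z.
Proof.
move=> zD z'D.
pose t (y : Zd d) := [tuple `|coord y i|%N | i < d].
have cnt y a : count_mem a (t y) = #|[set i | `|coord y i|%N == a]%SET|.
  by rewrite /= count_map card_cond_enum; apply: eq_count.
have : perm_eq (t z') (t z).
  apply/allP => a _; apply/eqP; rewrite !cnt.
  case: a => [|a].
    by apply/eqP; rewrite -(eqn_add2r (\sum_j n j)) !Dset_card0.
  have [aK|Ka] := ltnP a K.
    by case: zD => _ /(_ (Ordinal aK)) ->; case: z'D => _ /(_ (Ordinal aK)) ->.
  have big y : Dset d n y -> #|[set i | `|coord y i|%N == a.+1]%SET| = 0%N.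
    move=> [yK _]; apply/eqP; rewrite cards_eq0; apply/eqP/setP => i.
    rewrite !inE; apply/negbTE; rewrite neq_ltn.
    by have := yK i; rewrite -abszE lez_nat => /leq_ltn_trans ->.
  by rewrite !big.
move=> /tuple_permP[p tE].
have abs i : `|coord z' i|%N = `|coord z (p i)|%N.
  by have := congr1 (fun u => tnth u i) (val_inj tE); rewrite !tnth_mktuple.
(* The sign of coordinate i is read off at p i, hence the inverse of p. *)
exists (p, [set k | coord z' ((p^-1)%g k) != coord z k]%SET).
apply: coord_inj => i; rewrite coord_signed_perm/= inE permK.
have [->|ne] := eqVneq (coord z' i) (coord z (p i)); first by rewrite mul1r.
have /eqP := congr1 Posz (abs i); rewrite !abszE eqr_norm2 (negbTE ne)/=.
by move=> /eqP ->; rewrite expr1 mulN1r.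
Qed.

Context {R : realType}.

Definition shell_avg (n : 'I_K -> nat) (f : Zd d -> R) x :=
  #|` fset_set (Dset d n)|%:R^-1 * \sum_(y <- fset_set (Dset d n)) f (x - y).

Lemma sum_Dset_signed_perm (n : 'I_K -> nat) (h : Zd d -> R) g :
  \sum_(y <- fset_set (Dset d n)) h (signed_perm g y) =
  \sum_(y <- fset_set (Dset d n)) h y.
Proof.
set s := fset_set _.
have memE y : (y \in s) = `[< Dset d n y >].
  by rewrite in_fset_set ?mem_setE//; exact: finite_Dset.
have sub : {subset map (signed_perm g) s <= s}.
  move=> _ /mapP[y + ->]; rewrite !memE => /asboolP yD.
  exact/asboolP/signed_perm_Dset.
have us : uniq (map (signed_perm g) s).
  by rewrite (map_inj_uniq (@signed_perm_inj g)) fset_uniq.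
have [_ e] := uniq_min_size us sub (eq_leq (esym (size_map _ _))).
rewrite -(big_map (signed_perm g) predT h); apply: perm_big.
exact: uniq_perm us (fset_uniq _) e.
Qed.

(** The sum over the orbit does not depend on the starting point, by transitivity, and
    the sum over starting points in the shell is the same for every g, because g permutes
    the shell; double counting gives the identity. *)
Lemma shell_avg_signed_perm (n : 'I_K -> nat) (f : Zd d -> R) x z :
  Dset d n z ->
  \sum_g f (x - signed_perm g z) =
  #|{: 'S_d * {set 'I_d}}|%:R * shell_avg n f x.
Proof.
move=> zD; rewrite /shell_avg; set s := fset_set _.
have sn : #|` s|%:R != 0 :> R.
  rewrite pnatr_eq0 cardfs_eq0; apply/eqP => s0.
  have : z \in s by rewrite in_fset_set ?mem_setE//; [exact/asboolP|exact: finite_Dset].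
  by rewrite s0 in_fset0.
apply: (mulfI sn); rewrite [RHS]mulrCA mulVKf//.
transitivity (\sum_(y <- s) \sum_g f (x - signed_perm g y)).
  rewrite -sum1_size natr_sum mulr_suml big_seq [RHS]big_seq; apply: eq_bigr => y.
  rewrite in_fset_set ?mem_setE; last exact: finite_Dset.
  move=> /asboolP yD; rewrite mul1r.
  have [g' ->] := Dset_transitive zD yD.
  rewrite (reindex_inj (@signed_perm_mul_inj g')).
  by apply: eq_bigr => g _; rewrite signed_perm_mulP.
rewrite exchange_big/= (eq_bigr (fun=> \sum_(y <- s) f (x - y))).
  by rewrite sumr_const -[_ *+ _]mulr_natl.
by move=> g _; rewrite (sum_Dset_signed_perm _ (fun y => f (x - y))).
Qed.

Definition cube_fun (f : Zd d -> R) p x S := f (x - embed p S).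

(** The mean over signed permutations (p, w) of the cube maximal function, taken on the copy
    of the cube through x in which x sits at the corner w. *)
Definition majorant (f : Zd d -> R) x :=
  #|{: 'S_d * {set 'I_d}}|%:R^-1 * \sum_g
    block_max residue_block d.+1 (enum 'I_K)
      (cube_fun f g.1 (x + embed g.1 g.2)) g.2.

Lemma card_residue_block j : (d %/ K <= #|residue_block j|)%N.
Proof.
have lt (t : 'I_(d %/ K)) : (t * K + j < d)%N.
  rewrite (leq_trans _ (leq_trunc_div d K))//.
  by rewrite (leq_trans (n := t.+1 * K))// ?leq_mul2r ?ltn_ord ?orbT// mulSn addnC ltn_add2r.
rewrite -[X in (X <= _)%N]card_ord -(card_imset (f := fun t => Ordinal (lt t))).
  apply/subset_leq_card/subsetP => _ /imsetP[t _ ->].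
  by rewrite inE/= modnMDl modn_small.
move=> t u [] /eqP; rewrite eqn_add2r eqn_pmul2r// => /eqP tu.
exact: val_inj.
Qed.

(** The hypothesis on n makes room for n_j flips in at most half of each residue class.
    Then [block_avg] averages over subsets S with [embed 1 S] in the shell, and the
    sum over signed permutations is constant on these. *)
Lemma shell_avg_le_majorant (n : 'I_K -> nat) (f : Zd d -> R) x :
  (forall y, 0 <= f y) -> (forall j, (n j).*2 * K <= d)%N ->
  shell_avg n f x <= majorant f x.
Proof.
move=> f0 nd.
have nE j : ((n j).*2 <= #|residue_block j|)%N.
  by rewrite (leq_trans _ (card_residue_block j))// leq_divRL.
have nN j : (n j < d.+1)%N.
  rewrite ltnS (leq_trans _ (nd j))// (leq_trans (n := (n j).*2))//.
    by rewrite -addnn leq_addr.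
  by rewrite leq_pmulr.
have card0 : #|{: 'S_d * {set 'I_d}}|%:R != 0 :> R.
  by rewrite pnatr_eq0 -lt0n; apply/card_gt0P; exists (1%g, set0).
rewrite -(mulKf card0 (shell_avg n f x)) ler_wpM2l ?invr_ge0//.
set F := fun g => cube_fun f g.1 (x + embed g.1 g.2).
have <- : block_avg residue_block n (enum 'I_K)
    (fun S => \sum_g F g (symd S g.2)) set0 =
    #|{: 'S_d * {set 'I_d}}|%:R * shell_avg n f x.
  apply: block_avg_eq_cst => [|j _|j k _ _ jk|S Sn _].
  - exact: enum_uniq.
  - exact: nE.
  - apply/pred0P => i /=; rewrite !inE.
    apply/negbTE/negP => /andP[/eqP -> /eqP e]; case/eqP: jk; exact: val_inj.
  - rewrite -(shell_avg_signed_perm f x (z := embed 1 S)); last first.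
      by apply: embed_Dset => j; rewrite Sn// mem_enum.
    apply: eq_bigr => -[p w] _; rewrite /F /cube_fun/=.
    by rewrite (symdC set0) symd0 symdC -addrA embed_symd.
rewrite block_avg_sum; apply: ler_sum => g _.
rewrite -block_avg_symd symdC symd0.
apply: (le_trans (ler_norm _)); apply: norm_block_avg_le => // S.
exact: f0.
Qed.

End Lattice.

(** * Transference from the cube to Z^d *)

Lemma sqr_avg_le (R : realFieldType) (J : finType) (h : J -> R) :
  (#|J|%:R^-1 * \sum_j h j) ^+ 2 <= #|J|%:R^-1 * \sum_j h j ^+ 2.
Proof.
set m := _ * \sum_j h j.
have [J0|J0] := posnP #|J|.
  by rewrite /m J0 invr0 !mul0r expr0n.
have Jn : #|J|%:R != 0 :> R by rewrite pnatr_eq0 -lt0n.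
have : 0 <= #|J|%:R^-1 * \sum_j (h j - m) ^+ 2.
  by rewrite mulr_ge0 ?invr_ge0// sumr_ge0// => j _; exact: sqr_ge0.
rewrite [X in _ * X](_ : _ = \sum_j h j ^+ 2 - 2 * m * \sum_j h j + #|J|%:R * m ^+ 2).
  have -> : \sum_j h j = #|J|%:R * m by rewrite /m mulVKf.
  rewrite [X in 0 <= X](_ : _ = #|J|%:R^-1 * (\sum_j h j ^+ 2) - m ^+ 2).
    by rewrite subr_ge0.
  by field.
rewrite mulr_sumr -sumrB -mulr_natl -[X in _ + X](_ : \sum_(j : J) m ^+ 2 = _).
  by rewrite -big_split/=; apply: eq_bigr => j _; ring.
by rewrite sumr_const mulr_natl.
Qed.

Section Lp.
Context {R : realType} {d : nat}.
Local Notation card_measure := (@counting (Zd d) R).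

Lemma Zd_measurable_fun d' (Y : measurableType d') (D : set (Zd d)) (f : Zd d -> Y) :
  measurable_fun D f.
Proof. by []. Qed.

Lemma counting_shift (a : Zd d) (A : set (Zd d)) :
  card_measure ((fun x => x + a) @^-1` A)%classic = card_measure A.
Proof.
have e : (((fun x => x + a) @^-1` A) #= A)%card.
  rewrite (_ : (_ @^-1` A)%classic = ((fun x => x - a) @` A)%classic).
    by apply: inj_card_eq => x y _ _ /addIr.
  apply/seteqP; split => [x Ax|_ [x Ax <-]]; last by rewrite /= subrK.
  by exists (x + a) => //; rewrite addrK.
rewrite /counting; have [fA|nA] := pselect (finite_set A).
  have fA' : finite_set ((fun x => x + a) @^-1` A) by rewrite (eq_finite_set e).
  rewrite !asboolT//; congr (_%:R%:E); exact/(fcard_eq fA' fA).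
by rewrite !asboolF// (eq_finite_set e).
Qed.

Definition Zsum (f : Zd d -> R) : \bar R := (\int[card_measure]_x (f x)%:E)%E.

Lemma Zsum_shift (f : Zd d -> R) a : (forall x, 0 <= f x) ->
  Zsum (fun x => f (x + a)) = Zsum f.
Proof.
move=> f0; rewrite /Zsum.
have ms : @measurable_fun _ _ (Zd d) (Zd d) [set: Zd d]%classic (fun x => x + a).
  exact: Zd_measurable_fun.
have h : {in [set: Zd d]%classic, forall y, 0 <= (f y)%:E}%E.
  by move=> y _; rewrite lee_fin.
have mf : measurable_fun [set: Zd d]%classic (EFin \o f).
  exact: Zd_measurable_fun.
have := ge0_integral_pushforward ms card_measure measurableT mf h.
rewrite preimage_setT => <-.
by apply: eq_measure_integral => A _ _; exact: counting_shift.
Qed.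

Lemma le_Zsum (f g : Zd d -> R) : (forall x, 0 <= f x <= g x) ->
  (Zsum f <= Zsum g)%E.
Proof.
move=> fg; apply: ge0_le_integral => //= x _; rewrite lee_fin; by case/andP: (fg x).
Qed.

Lemma ZsumZ c (f : Zd d -> R) : 0 <= c -> (forall x, 0 <= f x) ->
  Zsum (fun x => c * f x)%R = (c%:E * Zsum f)%E.
Proof.
move=> c0 f0; rewrite /Zsum; under eq_integral do rewrite EFinM.
by rewrite ge0_integralZl_EFin// => x _; rewrite lee_fin.
Qed.

Lemma Zsum_sum (I : Type) (r : seq I) (f : I -> Zd d -> R) :
  (forall i x, 0 <= f i x) ->
  Zsum (fun x => \sum_(i <- r) f i x) = (\sum_(i <- r) Zsum (f i))%E.
Proof.
move=> f0; rewrite /Zsum; under eq_integral do rewrite -sumEFin.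
by rewrite ge0_integral_sum// => i x _; rewrite lee_fin.
Qed.

Lemma Zsum_ge0 (f : Zd d -> R) : (forall x, 0 <= f x) -> (0 <= Zsum f)%E.
Proof. by move=> f0; apply: integral_ge0 => x _; rewrite lee_fin. Qed.

(** Summing over x first, the translation by the embedded corner disappears; for each p
    and x, what is left is a sum over all corners of one cube, where the bound for
    [block_max] applies. *)
Lemma Zsum_sqr_majorant_le K (f : Zd d -> R) :
  (Zsum (fun x => majorant (K := K) f x ^+ 2)%R <=
   (20 ^+ K)%R%:E * Zsum (fun x => f x ^+ 2)%R)%E.
Proof.
set G := ('S_d * {set 'I_d})%type.
pose B p x w := block_max (R := R) (@residue_block d K) d.+1 (enum 'I_K)
  (cube_fun (K := K) f p x) w.
have cG : 0 <= #|{: G}|%:R^-1 :> R by rewrite invr_ge0.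
apply: (@le_trans _ _ (Zsum (fun x => #|{: G}|%:R^-1 *
    \sum_(g : G) B g.1 (x + embed (K := K) g.1 g.2) g.2 ^+ 2)%R)).
  by apply: le_Zsum => x; rewrite sqr_ge0/= sqr_avg_le.
rewrite ZsumZ//; last by move=> x; rewrite sumr_ge0// => g _; exact: sqr_ge0.
rewrite Zsum_sum; last by move=> *; exact: sqr_ge0.
have shift (g : G) : Zsum (fun x => B g.1 (x + embed (K := K) g.1 g.2) g.2 ^+ 2) =
    Zsum (fun x => B g.1 x g.2 ^+ 2).
  by rewrite (Zsum_shift (f := fun x => B g.1 x g.2 ^+ 2))// => x; exact: sqr_ge0.
rewrite (eq_bigr _ (fun g _ => shift g)).
rewrite -(pair_big predT predT (fun p w => Zsum (fun x => B p x w ^+ 2)%R))/=.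
have fixed p : (\sum_w Zsum (fun x => B p x w ^+ 2)%R <=
    (20 ^+ K)%R%:E * (#|{: {set 'I_d}}|%:R%:E * Zsum (fun x => f x ^+ 2)%R))%E.
  rewrite -Zsum_sum; last by move=> *; exact: sqr_ge0.
  apply: (@le_trans _ _ (Zsum (fun x =>
      20 ^+ K * \sum_w f (x - embed (K := K) p w) ^+ 2)%R)).
    apply: le_Zsum => x; rewrite sumr_ge0 => [|w _]; last exact: sqr_ge0.
    rewrite -[K in 20 ^+ K]size_enum_ord; exact: sum_sqr_block_max_le.
  rewrite ZsumZ ?exprn_ge0//; last first.
    by move=> x; rewrite sumr_ge0// => w _; exact: sqr_ge0.
  rewrite lee_wpmul2l ?lee_fin ?exprn_ge0// Zsum_sum; last first.
    by move=> *; exact: sqr_ge0.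
  rewrite (eq_bigr (fun=> Zsum (fun x => f x ^+ 2)%R)) => [|w _].
    by rewrite sumr_const mule_natl.
  by rewrite -[RHS](Zsum_shift (- embed (K := K) p w))// => x; exact: sqr_ge0.
apply: (@le_trans _ _ ((#|{: G}|%:R^-1)%R%:E * \sum_(p : 'S_d)
    ((20 ^+ K)%R%:E * (#|{: {set 'I_d}}|%:R%:E * Zsum (fun x => f x ^+ 2)%R)))%E).
  by rewrite lee_wpmul2l ?lee_fin// lee_sum.
set I := Zsum _; have -> : (\sum_(p : 'S_d)
    ((20 ^+ K)%R%:E * (#|{: {set 'I_d}}|%:R%:E * I)) =
    #|{: 'S_d}|%:R%:E * ((20 ^+ K)%R%:E * (#|{: {set 'I_d}}|%:R%:E * I)))%E.
  by rewrite sumr_const [RHS]mule_natl.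
have G0 : #|{: G}|%:R != 0 :> R.
  by rewrite pnatr_eq0 -lt0n; apply/card_gt0P; exists (1%g, set0).
rewrite !muleA -!EFinM.
have -> : #|{: G}|%:R^-1 * #|{: 'S_d}|%:R * 20 ^+ K * #|{: {set 'I_d}}|%:R =
    20 ^+ K :> R.
  move: G0; rewrite card_prod natrM => G0.
  by rewrite mulrAC -(mulrA _ #|{: 'S_d}|%:R) mulVf// mul1r.
by [].
Qed.

End Lp.

(** * The maximal theorem *)

(** Jensen's inequality, from Young's inequality h t^(q-1) <= h^q / q + t^q / q' at the
    mean t of h. *)
Lemma powR_avg_le (R : realType) (I : Type) (s : seq I) (h : I -> R) (q : R) :
  1 <= q -> (forall i, 0 <= h i) ->
  ((size s)%:R^-1 * \sum_(i <- s) h i) `^ q <=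
  (size s)%:R^-1 * \sum_(i <- s) h i `^ q.
Proof.
move=> q1 h0; set t := _ * _.
have q0 : 0 < q by exact: lt_le_trans q1.
have t0 : 0 <= t by rewrite mulr_ge0 ?invr_ge0 ?sumr_ge0.
have rhs0 : 0 <= (size s)%:R^-1 * \sum_(i <- s) h i `^ q.
  by rewrite mulr_ge0 ?invr_ge0 ?sumr_ge0// => i _; exact: powR_ge0.
move: q1; rewrite le_eqVlt => /predU1P[q1|q1].
  rewrite -q1 powRr1// /t ler_wpM2l ?invr_ge0//.
  by apply: ler_sum => i _; rewrite powRr1.
move: t0; rewrite le_eqVlt => /predU1P[<-|t0].
  by rewrite powR0// gt_eqF.
have s0 : (size s)%:R != 0 :> R.
  by apply: contraTneq t0 => e; rewrite /t e invr0 mul0r ltxx.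
have q10 : 0 < q - 1 by rewrite subr_gt0.
pose q' := q / (q - 1).
have q'0 : 0 < q' by exact: divr_gt0.
have qq' : q^-1 + q'^-1 = 1 by rewrite /q'; field; rewrite !gt_eqF.
have tq : (t `^ (q - 1)) `^ q' = t `^ q.
  by rewrite -powRrM /q' mulrC -mulrA mulVf ?mulr1// gt_eqF.
have young i : h i * t `^ (q - 1) <= h i `^ q / q + t `^ q / q'.
  by rewrite -tq; apply: conjugate_powR => //; exact: powR_ge0.
have : \sum_(i <- s) h i * t `^ (q - 1) <=
    \sum_(i <- s) (h i `^ q / q + t `^ q / q') by apply: ler_sum => i _; exact: young.
rewrite -mulr_suml big_split/= -mulr_suml big_const_seq count_predT iter_addr_0.
have -> : \sum_(i <- s) h i = (size s)%:R * t by rewrite /t mulVKf.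
have tt : t * t `^ (q - 1) = t `^ q.
  rewrite -{1}(powRr1 (ltW t0)) -powRD; first by congr (_ `^ _); ring.
  by rewrite (gt_eqF t0) implybT.
rewrite -mulrA tt -[X in _ + X]mulr_natl.
have -> : q'^-1 = 1 - q^-1 by rewrite -qq' addrAC subrr add0r.
move=> H; have szp : 0 < (size s)%:R :> R by rewrite lt0r s0 ler0n.
have u0 : 0 < q^-1 by rewrite invr_gt0.
rewrite mulrC ler_pdivlMr// -(ler_pM2r u0).
set S := \sum_(i <- s) _ in H *; move: H u0.
move: (t `^ q) (q^-1) ((size s)%:R : R) => P u N H u0; nra.
Qed.

Section Modulus.
Context {R : realType} {d K : nat}.
Implicit Types (f : Zd d -> R[i]) (n : 'I_K -> nat).

Lemma modulus_ge0 (z : R[i]) : 0 <= modulus z.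
Proof. by case: z => a b; exact: sqrtr_ge0. Qed.

Lemma modulus_sum (I : Type) (s : seq I) (F : I -> R[i]) :
  modulus (\sum_(i <- s) F i) <= \sum_(i <- s) modulus (F i).
Proof.
apply: (big_ind2 (fun z a => modulus z <= a)) => //.
  by rewrite /modulus ComplexField.Normc.normc0.
by move=> z a w b za wb; apply: (le_trans (le_normcD _ _)); exact: lerD.
Qed.

Lemma modulus_natV m : modulus (m%:R^-1 : R[i]) = m%:R^-1.
Proof.
rewrite /modulus ComplexField.Normc.normcV; congr (_^-1).
by have := normcMn (1 : R[i]) m; rewrite ComplexField.Normc.normc1.
Qed.

Lemma modulus_Davg_le n f x :
  modulus (Davg n f x) <= shell_avg n (fun y => modulus (f y)) x.
Proof.
rewrite /Davg fsbig_finite; last exact: finite_Dset.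
rewrite /modulus ComplexField.Normc.normcM -!/(modulus _) modulus_natV.
by rewrite ler_wpM2l ?invr_ge0//; exact: modulus_sum.
Qed.

Lemma shell_avg_le n (h : Zd d -> R) x M : 0 <= M -> (forall y, h y <= M) ->
  shell_avg n h x <= M.
Proof.
move=> M0 hM; rewrite /shell_avg; set s := fset_set _.
have [s0|s0] := posnP (#|` s|); first by rewrite s0 invr0 mul0r.
rewrite mulrC ler_pdivrMr ?ltr0n//.
apply: (@le_trans _ _ (\sum_(y <- s) M)); first by apply: ler_sum.
by rewrite big_const_seq count_predT iter_addr_0 mulr_natr.
Qed.

End Modulus.

Lemma counting_eq0 (R : realType) (T : choiceType) (A : classical_sets.set T) :
  @counting T R A = 0%E -> forall x, ~ A x.
Proof.
rewrite /counting; case: asboolP => // fA [/eqP].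
rewrite pnatr_eq0 cardfs_eq0 => /eqP A0 x Ax.
by have : x \in fset_set A; [rewrite in_fset_set//; exact: mem_set | rewrite A0 in_fset0].
Qed.

Section Maximal.
Context {R : realType} {d K : nat}.
Hypothesis K0 : (0 < K)%N.
Variable f : Zd d -> R[i].

Lemma index_cond (n : 'I_K -> nat) j : (n j)%:R <= d%:R / (2 * K%:R) :> R ->
  ((n j).*2 * K <= d)%N.
Proof.
rewrite ler_pdivlMr ?mulr_gt0 ?ltr0n// -natrM -natrM ler_nat.
by rewrite -muln2 -mulnA.
Qed.

Lemma Dmax_ge0 x : (0 <= Dmax K f x)%E.
Proof.
apply: (@le_trans _ _ (modulus (Davg (fun _ : 'I_K => 0%N) f x))%:E).
  by rewrite lee_fin modulus_ge0.
apply: ereal_sup_ubound; exists (fun=> 0%N) => //= j.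
by rewrite divr_ge0 ?mulr_ge0.
Qed.

Lemma Dmax_le x (M : \bar R) :
  (forall n : 'I_K -> nat, (forall j, ((n j).*2 * K <= d)%N) ->
    (modulus (Davg n f x))%:E <= M)%E ->
  (Dmax K f x <= M)%E.
Proof.
move=> H; apply/ereal_supP => _ [n nd <-]; apply: H => j.
by apply: index_cond; exact: nd.
Qed.

Lemma Dmax_powR_le (r : R) x : 2 <= r ->
  (Dmax K f x `^ r <=
   (majorant (K := K) (fun y => modulus (f y) `^ (r / 2)) x ^+ 2)%:E)%E.
Proof.
move=> r2; set m := majorant _ _.
have r0 : 0 < r by exact: lt_le_trans r2.
have q1 : 1 <= r / 2 by rewrite ler_pdivlMr// mul1r.
have q0 : 0 < r / 2 by exact: divr_gt0.
have H (n : 'I_K -> nat) : (forall j, ((n j).*2 * K <= d)%N) ->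
    modulus (Davg n f x) `^ (r / 2) <= m.
  move=> nd; apply: le_trans (shell_avg_le_majorant K0 _ _ nd); last first.
    by move=> y; exact: powR_ge0.
  apply: (@le_trans _ _ (shell_avg n (fun y => modulus (f y)) x `^ (r / 2))).
    rewrite ge0_ler_powR ?(ltW q0)// ?nnegrE ?modulus_ge0//.
      by rewrite (le_trans (modulus_ge0 _) (modulus_Davg_le _ _ _)).
    exact: modulus_Davg_le.
  by apply: powR_avg_le => // y; exact: modulus_ge0.
have m0 : 0 <= m.
  by apply: le_trans (powR_ge0 _ _) (H (fun=> 0%N) (fun=> leq0n d)).
have DM : (Dmax K f x <= (m `^ (r / 2)^-1)%:E)%E.
  apply: Dmax_le => n nd; rewrite lee_fin.
  have -> : modulus (Davg n f x) = (modulus (Davg n f x) `^ (r / 2)) `^ (r / 2)^-1.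
    by rewrite -powRrM mulfV ?gt_eqF// powRr1 ?modulus_ge0.
  by rewrite ge0_ler_powR ?invr_ge0 ?(ltW q0)// ?nnegrE ?powR_ge0// H.
have -> : (m ^+ 2)%:E = ((m `^ (r / 2)^-1)%:E `^ r)%E.
  rewrite poweR_EFin -powRrM; congr (_%:E).
  have -> : (r / 2)^-1 * r = 2%:R by field; rewrite gt_eqF.
  by rewrite powR_mulrn.
apply: gt0_ler_poweR; rewrite ?(ltW r0)// in_itv/= ?Dmax_ge0 ?leey//.
by rewrite lee_fin powR_ge0.
Qed.

End Maximal.

Theorem theorem1p5 (R : realType) (K : nat) (hK : (0 < K)%N) :
  exists C : R, 0 < C /\
    forall (d : nat) (p : \bar R) (f : Zd d -> R[i]),
      (0 < d)%N -> (2%:E <= p)%E -> in_lp p f ->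
      (lp_norm p (Dmax K f) <= C%:E * lp_norm p (fun x => (modulus (f x))%:E))%E.
Proof.
have C1 : 1 <= 20 ^+ K :> R by rewrite exprn_ege1 ?ler1n.
have C0 : 0 < 20 ^+ K :> R by exact: lt_le_trans C1.
(* A factor 20 per block for sums of squares; taking an r-th root, r >= 1, only
   decreases the constant. *)
exists (20 ^+ K); split=> // d p f _ p2 _.
rewrite /lp_norm unlock; case: p p2 => [r|_|//].
- rewrite lee_fin => r2; have r0 : 0 < r by exact: lt_le_trans r2.
  set g := fun y => modulus (f y) `^ (r / 2).
  have gE x : g x ^+ 2 = modulus (f x) `^ r.
    rewrite /g -powR_mulrn ?powR_ge0// -powRrM; congr (_ `^ _).
    by field.
  have lhs : (\int[counting]_x `|Dmax K f x| `^ r <=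
      (20 ^+ K)%:E * Zsum (fun x => g x ^+ 2)%R)%E.
    apply: le_trans (Zsum_sqr_majorant_le K g).
    apply: ge0_le_integral => // x _; first exact: poweR_ge0.
    by rewrite gee0_abs ?Dmax_ge0//; exact: Dmax_powR_le.
  have rhs : (\int[counting]_x `|(modulus (f x))%:E| `^ r)%E =
      Zsum (fun x => g x ^+ 2)%R.
    apply: eq_integral => x _.
    by rewrite gE gee0_abs ?lee_fin ?modulus_ge0// poweR_EFin.
  rewrite rhs.
  have Z0 : (0 <= Zsum (fun x => g x ^+ 2)%R)%E.
    by apply: Zsum_ge0 => x; exact: sqr_ge0.
  apply: (@le_trans _ _ (((20 ^+ K)%:E * Zsum (fun x => g x ^+ 2)%R) `^ r^-1)%E).
    apply: gt0_ler_poweR; rewrite ?invr_ge0 ?(ltW r0)// in_itv/= leey andbT.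
      by apply: integral_ge0 => x _; exact: poweR_ge0.
    by rewrite mule_ge0// lee_fin ltW.
  rewrite poweRM ?lee_fin ?(ltW C0)// poweR_EFin.
  rewrite lee_wpmul2r ?poweR_ge0// lee_fin -[leRHS]powRr1 ?(ltW C0)//.
  by rewrite ler_powR// invf_le1// (le_trans _ r2)// ler1n.
- have T0 : (0 < (@counting (Zd d) R) [set: Zd d]%classic)%E.
    by rewrite lt0e measure_ge0 andbT; apply/eqP => /counting_eq0/(_ 0 I).
  rewrite T0; set M := (X in (_ <= _ * X)%E).
  have fM x : ((modulus (f x))%:E <= M)%E.
    have [N [_ N0 fN]] := ess_sup_ge (@counting (Zd d) R)
      (abse \o (fun x => (modulus (f x))%:E)).
    apply: contrapT => fx; apply: (counting_eq0 N0 (x := x)); apply: fN => /=.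
    by rewrite ger0_norm ?modulus_ge0.
  have M0 : (0 <= M)%E.
    by apply: le_trans (fM 0); rewrite lee_fin modulus_ge0.
  apply: (@le_trans _ _ M); last first.
    by rewrite -[leLHS]mul1e lee_wpmul2r// lee_fin.
  apply/ess_supP; apply: aeW => x /=; rewrite gee0_abs ?Dmax_ge0//.
  apply: Dmax_le => // n _; move: M M0 fM => [m|_ _|//]; last by rewrite leey.
  rewrite !lee_fin => m0 fm; apply: (le_trans (modulus_Davg_le _ _ _)).
  by apply: shell_avg_le => // y; have := fm y; rewrite lee_fin.
Qed.
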